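(* (IKKT solution $\mathbb{R}^4\times T^2\times S^2$.) Let $N\geq 2$ be an integer and suppose given the following objects, mutually commuting (every element of one, including adjoints, commutes with every element of the others): Hermitian matrices $Y^1,Y^2,Y^3$ forming a fuzzy sphere, with $\xi\in\mathbb{R}$ such that $\sum_{j=1}^3[Y^j,[Y^j,Y^i]]=\xi^2Y^i$ for $i=1,2,3$; two fuzzy cylinders $(U_2,X^2)$ and $(U_3,X^3)$ with radius $1$ and equal NC moduli $\xi_2=\xi_3\in\mathbb{R}$; and Hermitian matrices $X^0,X^1$ with $[X^\mu,X^\nu]=i\theta^{\mu\nu}\mathbf 1$ for $\mu,\nu\in\{0,1\}$, where $\theta^{\mu\nu}$ is a real antisymmetric invertible $2\times2$ matrix. Let $k_0,k_1\in\mathbb{R}$ and define ten Hermitian matrices ${X^0}',\dots,{X^9}'$ by ${X^a}'=X^a$ for $a=0,1,2,3$ and $${X^4}'+i{X^5}'=Y^1U_2\,e^{ik_\mu X^\mu},\qquad {X^6}'+i{X^7}'=Y^2U_2\,e^{ik_\mu X^\mu},\qquad {X^8}'+i{X^9}'=Y^3U_3\,e^{ik_\mu X^\mu}$$ (sum over $\mu=0,1$). Set $k\cdot k:=\sum_{\mu,\nu,\mu',\nu'\in\{0,1\}}\theta^{\mu\mu'}\theta^{\nu\nu'}\eta_{\mu'\nu'}k_\mu k_\nu$. If $k\cdot k=-(\xi^2+\xi_3^2)$, then these matrices solve the IKKT equations of motion $$\sum_{b,c=0}^{9}\eta_{bc}[{X^b}',[{X^c}',{X^a}']]=0\qquad\text{for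 all }a=0,\dots,9.$$
   Context: Conventions: $\eta=\mathrm{diag}(-1,1,\dots,1)$ on indices $0,\dots,9$; $\mathbf 1$ is the identity. ''Matrices'' are operators on a separable Hilbert space; when they are unbounded, commutators and all identities are understood algebraically on a common invariant dense domain, so everything may be read as taking place in a unital complex $*$-algebra with involution $\dagger$. For a matrix $Z$ written as $Z=A+iB$ with $A,B$ Hermitian, $A=\tfrac12(Z+Z^\dagger)$ and $B=\tfrac1{2i}(Z-Z^\dagger)$. Fuzzy sphere: Hermitian matrices $Y^1,Y^2,Y^3$ (realized by $N\times N$ matrices) with $[Y^a,Y^b]=\frac{i}{\sqrt{C_N}}\sum_c\varepsilon^{abc}Y^c$ and $\sum_aY^aY^a=\mathbf 1$, where $C_N=\frac14(N^2-1)$. Fuzzy cylinder: a pair $(U,X)$ with $X=X^\dagger$ is a fuzzy cylinder with radius $R>0$ and NC modulus $\xi\in\mathbb{R}$ if $UU^\dagger=U^\dagger U=R^2\mathbf 1$, $[U,X]=\xi U$ and $[U^\dagger,X]=-\xi U^\dagger$. Plane waves: if $[X^\mu,X^\nu]=i\theta^{\mu\nu}\mathbf 1$, then $e^{ik_\mu X^\mu}$ denotes the usual unitary exponential, satisfying $[e^{ik_\mu X^\mu},X^\eta]=-k_\mu\theta^{\mu\eta}e^{ik_\mu X^\mu}$, and commuting with everything that commutes with all the $X^\mu$. *)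

(* Defs.v *)
(* MathComp, with the complex numbers R[i] over a realType R. *)
From HB Require Import structures.
From mathcomp Require Import all_boot all_order all_algebra.
From mathcomp Require Import reals complex.

Set Implicit Arguments.
Unset Strict Implicit.
Unset Printing Implicit Defensive.

Import Order.TTheory GRing.Theory Num.Theory.
Local Open Scope ring_scope.

(* Unital complex *-algebras.  No norm is required, so that this covers
   algebras of unbounded operators on a common invariant dense domain. *)
HB.mixin Record Algebra_isStar (R : realType) A of GRing.Algebra R[i] A := {
  dag : A -> A;
  dagD : forall x y, dag (x + y) = dag x + dag y;
  dagZ : forall (c : R[i]) x, dag (c *: x) = (c^*)%C *: dag x;
  dagM : forall x y, dag (x * y) = dag y * dag x;
  dagK : forall x, dag (dag x) = x
}.

#[short(type="starAlgType")]
HB.structure Definition StarAlgebra (R : realType) :=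
  { A of Algebra_isStar R A & GRing.Algebra R[i] A }.

Section StarAlgebraDefs.
Variables (R : realType) (A : starAlgType R).
Implicit Types (x y z : A).

Definition lie x y := x * y - y * x.

Definition is_hermitian x := dag x = x.

(* The Hermitian A and B in z = A + iB. *)
Definition hre z : A := (2^-1 : R[i]) *: (z + dag z).
Definition him z : A := ((2 * 'i%C)^-1 : R[i]) *: (z - dag z).

Lemma dagN z : dag (- z) = - dag z.
Proof. by rewrite -scaleN1r dagZ rmorphN rmorph1 scaleN1r. Qed.

Lemma hre_him z : hre z + ('i%C : R[i]) *: him z = z.
Proof.
have i0 : 'i%C != 0 :> R[i] by rewrite eq_complex /= oner_eq0 andbF.
rewrite /hre /him scalerA invfM mulrCA mulfV // mulr1.
rewrite -scalerDr addrACA subrr addr0 -mulr2n -(@scaler_nat R[i] A) scalerA.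
by rewrite mulVf ?scale1r // pnatr_eq0.
Qed.

Lemma hre_hermitian z : is_hermitian (hre z).
Proof. by rewrite /is_hermitian /hre dagZ dagD dagK addrC fmorphV rmorph_nat. Qed.

Lemma him_hermitian z : is_hermitian (him z).
Proof.
have conj2iV : (((2 * 'i)^-1)^*)%C = - ((2 * 'i)^-1)%C :> R[i].
  rewrite fmorphV rmorphM rmorph_nat -invrN -mulrN; congr (_ * _)^-1.
  by congr Complex; rewrite oppr0.
by rewrite /is_hermitian /him dagZ dagD dagN dagK conj2iV scaleNr -scalerN opprB.
Qed.

Definition star_commute x y :=
  [/\ GRing.comm x y, GRing.comm x (dag y),
      GRing.comm (dag x) y & GRing.comm (dag x) (dag y)].

(* Each object is given by the list of its elements; nothing is required of
   two elements of the same object. *)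
Definition mutually_commuting (objs : seq (seq A)) :=
  forall i j, (i < size objs)%N -> (j < size objs)%N -> i != j ->
  forall x y, x \in nth [::] objs i -> y \in nth [::] objs j ->
  star_commute x y.

(* The indices 1, 2, 3 are 0, 1, 2 : 'I_3, added modulo 3. *)
Definition levi_civita (a b c : 'I_3) : R[i] :=
  if (b == a + 1) && (c == b + 1) then 1
  else if (b == a - 1) && (c == b - 1) then -1
  else 0.

Definition fuzzy_sphere_const (N : nat) : R := (N%:R ^+ 2 - 1) / 4.

Definition fuzzy_sphere (N : nat) (Y : 'I_3 -> A) :=
  [/\ forall a, is_hermitian (Y a),
      forall a b, lie (Y a) (Y b) =
        ('i%C / (Num.sqrt (fuzzy_sphere_const N))%:C%C : R[i]) *:
          \sum_(c < 3) levi_civita a b c *: Y c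
    & \sum_(a < 3) Y a * Y a = 1].

Definition fuzzy_cylinder (r xi : R) (U X : A) :=
  [/\ 0 < r, is_hermitian X,
      U * dag U = (r ^+ 2)%:C%C%:A /\ dag U * U = (r ^+ 2)%:C%C%:A,
      lie U X = xi%:C%C *: U
    & lie (dag U) X = - (xi%:C%C *: dag U)].

(* W plays the role of exp(i k_mu X^mu), where [X^mu, X^nu] = i theta^{mu nu} 1.
   A general *-algebra has no exponential: W is any unitary with the
   commutation properties of that exponential. *)
Definition plane_wave n (X : 'I_n -> A) (theta : 'M[R]_n) (k : 'I_n -> R)
    (W : A) :=
  [/\ W * dag W = 1 /\ dag W * W = 1,
      forall nu, lie W (X nu) = - ((\sum_mu k mu * theta mu nu)%:C%C *: W)
    & forall z, (forall mu, GRing.comm z (X mu)) -> GRing.comm z W].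

End StarAlgebraDefs.

(* diag(-1, 1, ..., 1); on nat, so that it serves any range of indices. *)
Definition eta (R : realType) (b c : nat) : R :=
  if b == c then (if b == 0%N then -1 else 1) else 0.

Definition ikkt_eom (R : realType) (A : starAlgType R) (X : 'I_10 -> A) :=
  forall a, \sum_(b < 10) \sum_(c < 10)
    (eta R b c)%:C%C *: lie (X b) (lie (X c) (X a)) = 0.

Definition wave_norm (R : realType) (theta : 'M[R]_2) (k : 'I_2 -> R) : R :=
  \sum_mu \sum_nu \sum_mu' \sum_nu'
    theta mu mu' * theta nu nu' * eta R mu' nu' * k mu * k nu.

(* Main.v *)
Require Import Defs.
From HB Require Import structures.
From mathcomp Require Import all_boot all_order all_algebra.
From mathcomp Require Import reals complex ring.

Import Order.TTheory GRing.Theory Num.Theory.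
Local Open Scope ring_scope.

(** For [Z] with Hermitian parts [P] and [Q], the inner double commutators with
    [P] and [Q] add up to half of [Z, [Z^+, .]] + [Z^+, [Z, .]], and the IKKT
    operator Box commutes with the involution; so it suffices that Box kills
    [X^0, ..., X^3] and the complex combinations [Z_i = Y^i V_i], where the
    [V_i] are commuting unitaries.  As [Z_i] is normal and an eigenvector of the
    commutator with each of [X^0, ..., X^3], its two contributions to Box of
    these cancel.  On [Z_i] the unitaries [V_j] drop out, the sphere directions
    contribute [xi^2], a cylinder contributes [xi_3^2] and the plane wave
    contributes [k . k]. *)

(** * Commutator calculus in a star-algebra *)

Section Lie.
Set Implicit Arguments.
Unset Strict Implicit.
Context {R : realType} {A : starAlgType R}.
Implicit Types (x y z p q u v w : A) (c : R[i]).

Lemma lieDl x y z : lie (x + y) z = lie x z + lie y z.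
Proof. by rewrite /lie mulrDl mulrDr opprD addrACA. Qed.

Lemma lieDr x y z : lie x (y + z) = lie x y + lie x z.
Proof. by rewrite /lie mulrDl mulrDr opprD addrACA. Qed.

Lemma lieC x y : lie x y = - lie y x.
Proof. by rewrite /lie opprB. Qed.

Lemma lieZl c x y : lie (c *: x) y = c *: lie x y.
Proof. by rewrite /lie -scalerAl -scalerAr scalerBr. Qed.

Lemma lieZr c x y : lie x (c *: y) = c *: lie x y.
Proof. by rewrite lieC lieZl (lieC x y) scalerN. Qed.

Lemma lieNl x y : lie (- x) y = - lie x y.
Proof. by rewrite -scaleN1r lieZl scaleN1r. Qed.

Lemma lieNr x y : lie x (- y) = - lie x y.
Proof. by rewrite lieC lieNl (lieC x y). Qed.

Lemma lie_comm x y : GRing.comm x y -> lie x y = 0.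
Proof. by rewrite /lie => ->; rewrite subrr. Qed.

Lemma lie0r x : lie x 0 = 0.
Proof. by rewrite /lie mul0r mulr0 subrr. Qed.

Lemma lie_dag x y : dag (lie x y) = - lie (dag x) (dag y).
Proof. by rewrite /lie dagD dagN !dagM opprB. Qed.

Lemma comm_lie x y z :
  GRing.comm x y -> GRing.comm x z -> GRing.comm x (lie y z).
Proof. by move=> xy xz; apply: commrB; apply: commrM. Qed.

(** Moving [u] and [w] to the right turns both products of the commutator into right multiples of
    [u * w = w * u]. *)
Lemma lieM2 x y u w : GRing.comm u y -> GRing.comm w x -> GRing.comm u w ->
  lie (x * u) (y * w) = lie x y * (u * w).
Proof.
move=> uy wx uw; rewrite /lie mulrBl -!mulrA; congr (_ - _).
  by rewrite [u * (y * w)]mulrA uy !mulrA.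
by congr (_ * _); rewrite mulrA wx -mulrA uw.
Qed.

Lemma lieMl x y z c : GRing.comm x z -> lie y z = c *: y ->
  lie (x * y) z = c *: (x * y).
Proof.
by move=> xz yz; rewrite scalerAr -yz /lie mulrBr !mulrA xz.
Qed.

Lemma lieMr x y z c : GRing.comm y z -> lie x z = c *: x ->
  lie (x * y) z = c *: (x * y).
Proof.
by move=> yz xz; rewrite scalerAl -xz /lie mulrBl -!mulrA yz.
Qed.

Lemma lie_dag_eigen (r : R) x z : is_hermitian z ->
  lie x z = r%:C%C *: x -> lie (dag x) z = - (r%:C%C *: dag x).
Proof.
move=> hz /(congr1 (@dag R A)).
by rewrite lie_dag hz dagZ conjc_real => <-; rewrite opprK.
Qed.

Lemma lie_lie_eigen c x z : lie x z = c *: x ->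
  lie z (lie z x) = c ^+ 2 *: x.
Proof.
move=> xz; rewrite (lieC z x) xz lieNr lieZr.
by rewrite (lieC z x) xz scalerN opprK scalerA.
Qed.

(** [dag v] is the inverse of [v], and commuting with an invertible element passes to its
    inverse. *)
Lemma comm_unitary_dag v x : v * dag v = 1 -> dag v * v = 1 ->
  GRing.comm x v -> GRing.comm x (dag v).
Proof.
move=> v1 v2 xv; rewrite /GRing.comm -[LHS]mul1r -v2 -mulrA.
by rewrite (mulrA v) -xv -(mulrA x) v1 mulr1.
Qed.

Lemma dag_eq_hre_him z : dag z = hre z - ('i%C : R[i]) *: him z.
Proof.
rewrite -{1}(hre_him z) dagD hre_hermitian dagZ him_hermitian.
rewrite -scaleNr; congr (_ + _ *: _).
by congr Complex; rewrite oppr0.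
Qed.

(** Write [z = p + s] and [dag z = p - s] with [s = i q]. The mixed terms of the two double
    commutators cancel, and [i ^ 2 = -1] turns [- [s, [s, x]]] into [[q, [q, x]]]. *)
Lemma lie_lie_hre_him z x :
  lie (hre z) (lie (hre z) x) + lie (him z) (lie (him z) x) =
  (2^-1 : R[i]) *: (lie z (lie (dag z) x) + lie (dag z) (lie z x)).
Proof.
rewrite dag_eq_hre_him; move: (hre z) (him z) (hre_him z) => p q <-.
set s := 'i%C *: q.
have -> : lie q (lie q x) = - lie s (lie s x).
  by rewrite /s !lieZl lieZr scalerA -expr2 sqr_i scaleN1r opprK.
rewrite (lieDl p (- s) x) lieNl (lieDl p s x).
move: (lie p x) (lie s x) => a b.
have -> : lie (p + s) (a - b) + lie (p - s) (a + b) =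
    (2%:R : R[i]) *: (lie p a - lie s b).
  rewrite !lieDl !lieDr !lieNl !lieNr scaler_nat mulr2n.
  rewrite addrACA [in RHS]addrACA; congr (_ + _).
    by rewrite addrACA (addNr (lie p b)) addr0.
  by rewrite addrACA (subrr (lie s a)) add0r.
by rewrite scalerA mulVf ?scale1r // pnatr_eq0.
Qed.

(** From [[z, t] = r z] follows [[z^+, t] = - r z^+], so both double commutators are multiples of
    [[z, z^+] = 0]. *)
Lemma lie_lie_hre_him_normal (r : R) z t : is_hermitian t ->
  GRing.comm z (dag z) -> lie z t = r%:C%C *: z ->
  lie (hre z) (lie (hre z) t) + lie (him z) (lie (him z) t) = 0.
Proof.
move=> ht zz zt; rewrite lie_lie_hre_him (lie_dag_eigen ht zt) zt.
by rewrite lieNr !lieZr !lie_comm ?scaler0 ?oppr0 ?addr0 ?scaler0.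
Qed.

(** As [(p v)^+ = p v^+], the two nested commutators leave [v] and [v^+] as factors beside [w],
    where they cancel. *)
Lemma lie_lie_hre_him_wave p q v w : is_hermitian p ->
  v * dag v = 1 -> dag v * v = 1 ->
  GRing.comm p v -> GRing.comm q v -> GRing.comm p w -> GRing.comm w v ->
  lie (hre (p * v)) (lie (hre (p * v)) (q * w)) +
  lie (him (p * v)) (lie (him (p * v)) (q * w)) = lie p (lie p q) * w.
Proof.
move=> hp v1 v2 pv qv pw wv.
(* Stated for two mutually inverse elements, so that it serves both orders, [v, v^+] and
   [v^+, v]. *)
have lie_pv u u' : u * u' = 1 -> u' * u = 1 -> GRing.comm p u ->
    GRing.comm q u -> GRing.comm w u -> GRing.comm p u' -> GRing.comm q u' ->
    GRing.comm w u' -> lie (p * u) (lie (p * u') (q * w)) = lie p (lie p q) * w.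
  move=> uu' u'u pu qu wu pu' qu' wu'.
  rewrite (@lieM2 p q); [|exact: commr_sym..].
  rewrite (@lieM2 p (lie p q)); first by rewrite (mulrA u) uu' mul1r.
  - by apply: comm_lie; apply: commr_sym.
  - by apply/commr_sym/commrM.
  - by apply: commrM; [rewrite /GRing.comm uu' u'u | exact: commr_sym].
have dcomm x : GRing.comm x v -> GRing.comm x (dag v).
  exact: comm_unitary_dag.
have [pv' qv' wv'] := And3 (dcomm p pv) (dcomm q qv) (dcomm w wv).
rewrite lie_lie_hre_him dagM hp -pv' !lie_pv //.
by rewrite -mulr2n -(@scaler_nat R[i] A) scalerA mulVf ?scale1r // pnatr_eq0.
Qed.

(** * The operator Box and its compatibility with the involution *)

Lemma dag0 : dag 0 = 0 :> A.
Proof. by rewrite -[X in dag X](scale0r 0) dagZ rmorph0 scale0r. Qed.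

(** The double sum of the equations of motion restricted to [b = c], outside which the metric
    vanishes. *)
Definition box n (X : 'I_n -> A) x :=
  \sum_(b < n) (Defs.eta R b b)%:C%C *: lie (X b) (lie (X b) x).

Lemma ikkt_eomE (X : 'I_10 -> A) :
  (forall a, box X (X a) = 0) -> ikkt_eom X.
Proof.
move=> h a; rewrite -[RHS](h a); apply: eq_bigr => b _.
rewrite (bigD1 b) //= big1 ?addr0 // => c.
by rewrite -val_eqE eq_sym /Defs.eta /= => /negPf ->; rewrite scale0r.
Qed.

Section Box.
Variables (n : nat) (X : 'I_n -> A).

Lemma boxD x y : box X (x + y) = box X x + box X y.
Proof. by rewrite -big_split; apply: eq_bigr => b _; rewrite !lieDr scalerDr. Qed.

Lemma boxZ c x : box X (c *: x) = c *: box X x.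
Proof.
by rewrite scaler_sumr; apply: eq_bigr => b _; rewrite !lieZr !scalerA mulrC.
Qed.

Hypothesis X_hermitian : forall b, is_hermitian (X b).

(** The involution gives each commutator with a Hermitian element a sign; the two signs cancel, and
    the metric is real. *)
Lemma box_dag x : box X (dag x) = dag (box X x).
Proof.
rewrite /box (big_morph _ (@dagD R A) dag0); apply: eq_bigr => b _.
by rewrite dagZ conjc_real !lie_dag X_hermitian lieNr opprK.
Qed.

Lemma box_hre_eq0 z : box X z = 0 -> box X (hre z) = 0.
Proof. by move=> h; rewrite boxZ boxD box_dag h dag0 addr0 scaler0. Qed.

Lemma box_him_eq0 z : box X z = 0 -> box X (him z) = 0.
Proof.
move=> h; rewrite boxZ boxD -scaleN1r boxZ box_dag h dag0.
by rewrite scaler0 addr0 scaler0.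
Qed.

End Box.

(** * Sphere coordinates multiplied by commuting unitaries *)

Section WaveSphere.
Variables (Y V : 'I_3 -> A) (x : 'I_4 -> A) (r : 'I_4 -> 'I_3 -> R) (xi : R).
Hypothesis Y_hermitian : forall i, is_hermitian (Y i).
Hypothesis Y_box :
  forall i, \sum_(j < 3) lie (Y j) (lie (Y j) (Y i)) = (xi ^+ 2)%:C%C *: Y i.
Hypothesis V_dag : forall i, V i * dag (V i) = 1.
Hypothesis dag_V : forall i, dag (V i) * V i = 1.
Hypothesis YV : forall i j, GRing.comm (Y i) (V j).
Hypothesis VV : forall i j, GRing.comm (V i) (V j).
Hypothesis x_hermitian : forall m, is_hermitian (x m).
Hypothesis x_box : forall m m', lie (x m) (lie (x m) (x m')) = 0.
Hypothesis Yx : forall i m, GRing.comm (Y i) (x m).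
Hypothesis Vx : forall i m, lie (V i) (x m) = (r m i)%:C%C *: V i.
(** The Lorentz square of the eigenvalues of each [V i] balances the contribution [xi ^ 2] of the
    sphere. *)
Hypothesis dispersion :
  forall i, \sum_(m < 4) Defs.eta R m m * r m i ^+ 2 = - xi ^+ 2.

Let Z i := Y i * V i.

Let F (a : 'I_10) :=
  [:: x 0; x 1; x 2; x 3; hre (Z 0); him (Z 0); hre (Z 1); him (Z 1);
      hre (Z 2); him (Z 2)]`_a.

Let F_hermitian a : is_hermitian (F a).
Proof.
rewrite /F; case: a => [[|[|[|[|[|[|[|[|[|[|m]]]]]]]]]] //= _] //;
  by [exact: hre_hermitian | exact: him_hermitian].
Qed.

(** Directions 4 to 9 all have metric sign [+1], so they group into the Hermitian pairs of the
    [Z j]. *)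
Let boxE t : box F t =
  \sum_(m < 4) (Defs.eta R m m)%:C%C *: lie (x m) (lie (x m) t) +
  \sum_(j < 3) (lie (hre (Z j)) (lie (hre (Z j)) t) +
                lie (him (Z j)) (lie (him (Z j)) t)).
Proof.
(* The indices produced by [big_ord_recl] are identified with numerals. *)
have e1 : lift ord0 ord0 = 1 :> 'I_4 by apply: val_inj.
have e2 : lift ord0 (lift ord0 ord0) = 2 :> 'I_4 by apply: val_inj.
have e3 : lift ord0 (lift ord0 (lift ord0 ord0)) = 3 :> 'I_4.
  by apply: val_inj.
have f1 : lift ord0 ord0 = 1 :> 'I_3 by apply: val_inj.
have f2 : lift ord0 (lift ord0 ord0) = 2 :> 'I_3 by apply: val_inj.
rewrite /box /F !big_ord_recl !big_ord0 /= /Defs.eta /= e1 e2 e3 f1 f2.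
by rewrite rmorph1 !scale1r !addr0 -!addrA.
Qed.

Let Zx i m : lie (Z i) (x m) = (r m i)%:C%C *: Z i.
Proof. exact: lieMl. Qed.

(** Both products reduce to [Y i * Y i] because [V i] is unitary and commutes with [Y i]. *)
Let Z_normal i : GRing.comm (Z i) (dag (Z i)).
Proof.
have YYV : GRing.comm (Y i * Y i) (V i).
  by apply: commr_sym; apply: commrM; apply: commr_sym; apply: YV.
rewrite /GRing.comm /Z dagM Y_hermitian -[LHS]mulrA (mulrA (V i)) V_dag mul1r.
by rewrite -[RHS]mulrA (mulrA (Y i) (Y i)) YYV (mulrA (dag (V i))) dag_V mul1r.
Qed.

Let box_x m : box F (x m) = 0.
Proof.
rewrite boxE big1 ?add0r => [|m' _]; last by rewrite x_box scaler0.
by apply: big1 => j _; apply: lie_lie_hre_him_normal (Zx j m).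
Qed.

Let box_Z i : box F (Z i) = 0.
Proof.
rewrite boxE; under [X in _ + X]eq_bigr => j _.
  rewrite lie_lie_hre_him_wave //; over.
rewrite -mulr_suml Y_box -scalerAl -/(Z i).
under eq_bigr => m _.
  rewrite (lie_lie_eigen (Zx i m)) scalerA -rmorphXn -rmorphM /=; over.
rewrite -scaler_suml -scalerDl -rmorph_sum -rmorphD dispersion.
by rewrite addNr rmorph0 scale0r.
Qed.

Lemma ikkt_eom_wave_sphere : ikkt_eom F.
Proof.
apply: ikkt_eomE; rewrite {2}/F.
case=> [[|[|[|[|[|[|[|[|[|[|m]]]]]]]]]] //= _] //;
  by [exact: box_hre_eq0 | exact: box_him_eq0].
Qed.

End WaveSphere.

End Lie.

(** * Application to the sphere, the cylinders and the plane wave *)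

Lemma wave_normE (R : realType) (theta : 'M[R]_2) (k : 'I_2 -> R) :
  wave_norm theta k =
  - (\sum_mu k mu * theta mu 0) ^+ 2 + (\sum_mu k mu * theta mu 1) ^+ 2.
Proof.
have e1 : lift ord0 ord0 = 1 :> 'I_2 by apply: val_inj.
(* The form [k . k] is the Lorentz square of the vector with components
   [\sum_mu k mu * theta mu nu]. *)
rewrite /wave_norm !big_ord_recl !big_ord0 /Defs.eta /= e1.
by ring.
Qed.

Theorem mainTheorem4 (R : realType) (A : starAlgType R) (N : nat)
    (Y : 'I_3 -> A) (U2 X2 U3 X3 : A) (X : 'I_2 -> A)
    (xi xi2 xi3 : R) (theta : 'M[R]_2) (k : 'I_2 -> R) (W : A) :
  (2 <= N)%N ->
  fuzzy_sphere N Y ->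
  (forall i, \sum_(j < 3) lie (Y j) (lie (Y j) (Y i)) = (xi ^+ 2)%:C%C *: Y i) ->
  fuzzy_cylinder 1 xi2 U2 X2 ->
  fuzzy_cylinder 1 xi3 U3 X3 ->
  xi2 = xi3 ->
  (forall mu, is_hermitian (X mu)) ->
  (forall mu nu, lie (X mu) (X nu) = ('i%C * (theta mu nu)%:C%C)%:A) ->
  theta^T = - theta ->
  theta \in unitmx ->
  mutually_commuting
    [:: [:: Y 0; Y 1; Y 2]; [:: U2; X2]; [:: U3; X3]; [:: X 0; X 1]] ->
  plane_wave X theta k W ->
  wave_norm theta k = - (xi ^+ 2 + xi3 ^+ 2) ->
  let Z1 := Y 0 * U2 * W in
  let Z2 := Y 1 * U2 * W in
  let Z3 := Y 2 * U3 * W in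
  ikkt_eom (fun a : 'I_10 =>
    [:: X 0; X 1; X2; X3; hre Z1; him Z1; hre Z2; him Z2; hre Z3; him Z3]`_a).
Proof.
move=> _ [hY _ _] boxY [_ hX2 [U2d dU2] U2X2 _] [_ hX3 [U3d dU3] U3X3 _].
move=> e23 hX lieX _ _ mc [[Wd dW] WX Wc] wn.
(* Both moduli become [xi2]; radius 1 makes [U2] and [U3] unitary. *)
rewrite -{}e23 in U3X3 wn; rewrite expr1n rmorph1 scale1r in U2d dU2 U3d dU3.
pose objs := [:: [:: Y 0; Y 1; Y 2]; [:: U2; X2]; [:: U3; X3]; [:: X 0; X 1]].
have {mc}mcc i j a b : (i < 4)%N -> (j < 4)%N -> i != j ->
    a \in nth [::] objs i -> b \in nth [::] objs j -> GRing.comm a b.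
  by move=> lti ltj ij ai bj; case: (mc i j lti ltj ij a b ai bj).
have Ym i : Y i \in [:: Y 0; Y 1; Y 2].
  have : i \in [:: 0; 1; 2] by case: i => [[|[|[|m]]]].
  by move/(map_f Y).
have Xm mu : X mu \in [:: X 0; X 1].
  have : mu \in [:: 0; 1] by case: mu => [[|[|m]]].
  by move/(map_f X).
have U2m : U2 \in [:: U2; X2] by exact: mem_head.
have X2m : X2 \in [:: U2; X2] by rewrite !inE eqxx orbT.
have U3m : U3 \in [:: U3; X3] by exact: mem_head.
have X3m : X3 \in [:: U3; X3] by rewrite !inE eqxx orbT.
have YU2 i : GRing.comm (Y i) U2 by apply: (mcc 0%N 1%N).
have YX2 i : GRing.comm (Y i) X2 by apply: (mcc 0%N 1%N).
have YU3 i : GRing.comm (Y i) U3 by apply: (mcc 0%N 2%N).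
have YX3 i : GRing.comm (Y i) X3 by apply: (mcc 0%N 2%N).
have YX i mu : GRing.comm (Y i) (X mu) by apply: (mcc 0%N 3%N).
have U2U3 : GRing.comm U2 U3 by apply: (mcc 1%N 2%N).
have U2X3 : GRing.comm U2 X3 by apply: (mcc 1%N 2%N).
have U3X2 : GRing.comm U3 X2 by apply: (mcc 2%N 1%N).
have X2X3 : GRing.comm X2 X3 by apply: (mcc 1%N 2%N).
have U2X mu : GRing.comm U2 (X mu) by apply: (mcc 1%N 3%N).
have X2X mu : GRing.comm X2 (X mu) by apply: (mcc 1%N 3%N).
have U3X mu : GRing.comm U3 (X mu) by apply: (mcc 2%N 3%N).
have X3X mu : GRing.comm X3 (X mu) by apply: (mcc 2%N 3%N).
have YW i := Wc _ (YX i).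
have U2W := Wc _ U2X.
have U3W := Wc _ U3X.
have X2W := Wc _ X2X.
have X3W := Wc _ X3X.
pose V (i : 'I_3) := [:: U2 * W; U2 * W; U3 * W]`_i.
pose x (m : 'I_4) := [:: X 0; X 1; X2; X3]`_m.
(* The first two eigenvalues come from [W]. The last two come from the cylinders: [V 0] and [V 1]
   shift only [X2], and [V 2] shifts only [X3]. *)
pose r (m : 'I_4) (i : 'I_3) : R :=
  [:: - \sum_mu k mu * theta mu 0; - \sum_mu k mu * theta mu 1;
      if i == 2 then 0 else xi2; if i == 2 then xi2 else 0]`_m.
rewrite -3!mulrA.
apply: (@ikkt_eom_wave_sphere _ _ Y V x r xi) => //.
- have VdV u : u * dag u = 1 -> u * W * dag (u * W) = 1.
    by move=> ud; rewrite dagM -mulrA (mulrA W) Wd mul1r.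
  by rewrite /V; case=> [[|[|[|m]]]] //= _; apply: VdV.
- have dVV u : dag u * u = 1 -> dag (u * W) * (u * W) = 1.
    by move=> du; rewrite dagM -mulrA (mulrA (dag u)) du mul1r.
  by rewrite /V; case=> [[|[|[|m]]]] //= _; apply: dVV.
- by rewrite /V => i; case=> [[|[|[|m]]]] //= _; apply: commrM.
- have UW u w : GRing.comm u W -> GRing.comm w W -> GRing.comm u w ->
      GRing.comm (u * W) (w * W).
    by move=> uW wW uw; apply: commrM; apply: commr_sym; apply: commrM.
  by rewrite /V; case=> [[|[|[|m]]]] //= _; case=> [[|[|[|m']]]] //= _;
    apply: UW; rewrite // /GRing.comm U2U3.
- by rewrite /x; case=> [[|[|[|[|m]]]]] /=.
(* The commutator of [X mu] and [X nu] is a scalar, hence central. *)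
- have lieXX mu nu z : lie z (lie (X mu) (X nu)) = 0.
    by rewrite lieX lieZr lie_comm ?scaler0 //; apply: commr1.
  have lie00 (z y : A) : GRing.comm z y -> lie z (lie z y) = 0.
    by move=> zy; rewrite (lie_comm zy) lie0r.
  by rewrite /x; case=> [[|[|[|[|m]]]]] //= _; case=> [[|[|[|[|m']]]]] //= _;
    rewrite ?lieXX ?lie00 //; apply: commr_sym.
- by rewrite /x => i; case=> [[|[|[|[|m]]]]] /=.
- have UX u mu : GRing.comm u (X mu) -> lie (u * W) (X mu) =
      (- \sum_nu k nu * theta nu mu)%:C%C *: (u * W).
    by move=> uX; apply: lieMl => //; rewrite WX rmorphN scaleNr.
  have X0 u z : GRing.comm u z -> GRing.comm z W ->
      lie (u * W) z = (0 : R)%:C%C *: (u * W).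
    move=> uz zW; rewrite rmorph0 scale0r; apply: lie_comm.
    by apply: commr_sym; apply: commrM => //; apply: commr_sym.
  (* Three cases: a plane-wave direction, the coordinate of the other cylinder, and the coordinate
     of the cylinder to which the unitary belongs. *)
  rewrite /x /V /r; case=> [[|[|[|i]]]] //= _; case=> [[|[|[|[|m]]]]] //= _;
    first [by apply: UX | by apply: X0 | by apply: lieMr => //; apply: commr_sym].
- move=> i; move: wn; rewrite wave_normE /r.
  move: (\sum_mu _) (\sum_mu _) => c1 c0 wn.
  rewrite !big_ord_recl big_ord0 /Defs.eta /= !sqrrN.
  (* For every [i] exactly one cylinder contributes [xi2 ^ 2], so the Lorentz square is
     [k . k + xi2 ^ 2 = - xi ^ 2]. *)
  have -> : - xi ^+ 2 = - c0 ^+ 2 + c1 ^+ 2 + xi2 ^+ 2 by rewrite wn; ring.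
  by case: ifP => _; rewrite !add0n /=; ring.
Qed.
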